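(* Fix $n\ge2$, points $\mathbf{X}_1,\dots,\mathbf{X}_n\in\mathbb{T}_d$, an index $i$, and assume $X_{j\ell}\in(a_\ell,b_\ell)$ for all $j\ne i$ and all $\ell$. Let $\alpha>3/2$ and $\beta_1,\dots,\beta_d>0$. Partition $\{1,\dots,d\}$ into $\mathbb{I}_a=\{\ell:X_{i\ell}=a_\ell\}$, $\mathbb{I}_b=\{\ell:X_{i\ell}=b_\ell\}$, $\mathbb{I}^c=\{\ell:X_{i\ell}\in(a_\ell,b_\ell)\}$. For $j\ne i$ define: for $\ell\in\mathbb{I}^c$: $B_{j\ell}=\beta_\ell-(b_\ell-a_\ell)^{-1}\big[(X_{i\ell}-a_\ell)\log\frac{X_{j\ell}-a_\ell}{X_{i\ell}-a_\ell}+(b_\ell-X_{i\ell})\log\frac{b_\ell-X_{j\ell}}{b_\ell-X_{i\ell}}\big]$, $A_{j\ell}=\{2\pi(X_{i\ell}-a_\ell)(b_\ell-X_{i\ell})\}^{-1/2}\beta_\ell^\alpha\Gamma(\alpha+\tfrac12)B_{j\ell}^{-\alpha-1/2}$, $C_{j\ell}=\{2\pi(X_{i\ell}-a_\ell)(b_\ell-X_{i\ell})\}^{-1/2}\beta_\ell^\alpha\Gamma(\alpha-\tfrac12)B_{j\ell}^{-\alpha+1/2}$, and set $M_{j\ell}(t)=A_{j\ell}IG_{\alpha+1/2,B_{j\ell}}(t)+C_{j\ell}IG_{\alpha-1/2,B_{j\ell}}(t)$, $w_{j\ell}=A_{j\ell}+C_{j\ell}$, $\mu_{j\ell}=B_{j\ell}\big(\frac{A_{j\ell}}{\alpha-1/2}+\frac{C_{j\ell}}{\alpha-3/2}\big)$;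 for $\ell\in\mathbb{I}_a$: $E_{j\ell}=\beta_\ell-\log\frac{b_\ell-X_{j\ell}}{b_\ell-a_\ell}$, $F_{j\ell}=\beta_\ell^\alpha(b_\ell-a_\ell)^{-1}\Gamma(\alpha)E_{j\ell}^{-\alpha}$, $H_{j\ell}=\beta_\ell^\alpha(b_\ell-a_\ell)^{-1}\Gamma(\alpha+1)E_{j\ell}^{-\alpha-1}$, $M_{j\ell}(t)=F_{j\ell}IG_{\alpha,E_{j\ell}}(t)+H_{j\ell}IG_{\alpha+1,E_{j\ell}}(t)$, $w_{j\ell}=F_{j\ell}+H_{j\ell}$, $\mu_{j\ell}=E_{j\ell}\big(\frac{F_{j\ell}}{\alpha-1}+\frac{H_{j\ell}}{\alpha}\big)$; for $\ell\in\mathbb{I}_b$: $G_{j\ell}=\beta_\ell-\log\frac{X_{j\ell}-a_\ell}{b_\ell-a_\ell}$, $J_{j\ell}=\beta_\ell^\alpha(b_\ell-a_\ell)^{-1}\Gamma(\alpha)G_{j\ell}^{-\alpha}$, $K_{j\ell}=\beta_\ell^\alpha(b_\ell-a_\ell)^{-1}\Gamma(\alpha+1)G_{j\ell}^{-\alpha-1}$, $M_{j\ell}(t)=J_{j\ell}IG_{\alpha,G_{j\ell}}(t)+K_{j\ell}IG_{\alpha+1,G_{j\ell}}(t)$, $w_{j\ell}=J_{j\ell}+K_{j\ell}$, $\mu_{j\ell}=G_{j\ell}\big(\frac{J_{j\ell}}{\alpha-1}+\frac{K_{j\ell}}{\alpha}\big)$. Let $D_i=\sum_{j\ne i}\prod_{\ell=1}^dw_{j\ell}$.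 Then (i) the posterior density defined in the context is $$\pi(\boldsymbol{h}\mid\mathbf{X}_i)=\frac1{D_i}\sum_{j=1,j\ne i}^n\prod_{\ell=1}^dM_{j\ell}(h_\ell),\qquad\boldsymbol{h}\in(0,\infty)^d;$$ (ii) the posterior mean (Bayes estimator under quadratic loss) $\widetilde{\boldsymbol h}_i=\mathbb{E}(\boldsymbol h\mid\mathbf{X}_i)$ has components $$\widetilde h_{im}=\frac1{D_i}\sum_{j=1,j\ne i}^n\Big(\prod_{\ell\ne m}w_{j\ell}\Big)\mu_{jm},\qquad m=1,\dots,d.$$
   Context: $\mathbb{T}_d=\prod_{\ell=1}^d[a_\ell,b_\ell]$, $-\infty<a_\ell<b_\ell<\infty$; $\mathbf{X}_j=(X_{j1},\dots,X_{jd})^\top$. For $a'>0,b'>0$, $IG_{a',b'}(t)=\frac{b'^{a'}}{\Gamma(a')}t^{-a'-1}e^{-b'/t}\mathbf 1_{(0,\infty)}(t)$ is the inverse-gamma density. The extended-beta kernel is $EB_{x,h,a,b}(u)=\frac{(u-a)^{(x-a)/\{(b-a)h\}}(b-u)^{(b-x)/\{(b-a)h\}}}{(b-a)^{1+1/h}B\{1+(x-a)/((b-a)h),1+(b-x)/((b-a)h)\}}\mathbf 1_{[a,b]}(u)$ ($B$ the beta function, $0^0=1$); in particular $EB_{a,h,a,b}(u)=(1+1/h)(b-u)^{1/h}(b-a)^{-1-1/h}$ and $EB_{b,h,a,b}(u)=(1+1/h)(u-a)^{1/h}(b-a)^{-1-1/h}$ on $[a,b]$. For interior $x\in(a,b)$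 the paper replaces $EB_{x,h,a,b}$ by its large-$1/h$ Stirling approximation $$\widetilde{EB}_{x,h,a,b}(u)=\frac{(1+h)\,h^{-1/2}}{\sqrt{2\pi(x-a)(b-x)}}\exp\Big\{\frac{1}{(b-a)h}\Big[(x-a)\log\frac{u-a}{x-a}+(b-x)\log\frac{b-u}{b-x}\Big]\Big\},\quad u\in(a,b).$$ For $\boldsymbol h=(h_1,\dots,h_d)\in(0,\infty)^d$ let $\kappa_\ell(u;h_\ell)=EB_{X_{i\ell},h_\ell,a_\ell,b_\ell}(u)$ if $\ell\in\mathbb{I}_a\cup\mathbb{I}_b$ and $\kappa_\ell(u;h_\ell)=\widetilde{EB}_{X_{i\ell},h_\ell,a_\ell,b_\ell}(u)$ if $\ell\in\mathbb{I}^c$; the (approximate) leave-one-out estimator is $\widehat f_{-i}(\mathbf X_i\mid\boldsymbol h)=\frac1{n-1}\sum_{j\ne i}\prod_{\ell=1}^d\kappa_\ell(X_{j\ell};h_\ell)$. The prior on the adaptive bandwidth vector is $\pi(\boldsymbol h)=\prod_{\ell=1}^dIG_{\alpha,\beta_\ell}(h_\ell)$ and the posterior is $\pi(\boldsymbol h\mid\mathbf X_i)=\widehat f_{-i}(\mathbf X_i\mid\boldsymbol h)\pi(\boldsymbol h)\big/\int_{(0,\infty)^d}\widehat f_{-i}(\mathbf X_i\mid\boldsymbol g)\pi(\boldsymbol g)d\boldsymbol g$. *)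

(* Defs.v *)
From HB Require Import structures.
From mathcomp Require Import all_boot all_order all_algebra.
From mathcomp Require Import all_classical all_reals all_analysis.

Set Implicit Arguments.
Unset Strict Implicit.
Unset Printing Implicit Defensive.

Import Order.TTheory GRing.Theory Num.Theory.
Import numFieldNormedType.Exports.

Local Open Scope classical_set_scope.
Local Open Scope ring_scope.

Section Defs.
Variable R : realType.

Notation leb := (@lebesgue_measure R).

Definition Gamma (a : R) : R :=
  (\int[leb]_(t in `]0, +oo[) (t `^ (a - 1) * expR (- t)))%R.

Definition Beta (p q : R) : R :=
  (\int[leb]_(t in `[0, 1]) (t `^ (p - 1) * (1 - t) `^ (q - 1)))%R.

Definition IG (a' b' t : R) : R :=
  if 0 < t then b' `^ a' / Gamma a' * t `^ (- a' - 1) * expR (- (b' / t))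
  else 0.

(** Extended-beta kernel EB_{x,h,a,b}(u) (powR satisfies 0 `^ 0 = 1). *)
Definition EB (x h a b u : R) : R :=
  if (a <= u) && (u <= b) then
    (u - a) `^ ((x - a) / ((b - a) * h)) * (b - u) `^ ((b - x) / ((b - a) * h))
    / ((b - a) `^ (1 + h^-1) *
       Beta (1 + (x - a) / ((b - a) * h)) (1 + (b - x) / ((b - a) * h)))
  else 0.

(** Stirling approximation of EB for interior x (on (a,b); 0 elsewhere). *)
Definition EBt (x h a b u : R) : R :=
  if (a < u) && (u < b) then
    (1 + h) * h `^ (- 2^-1) / Num.sqrt (2 * pi * (x - a) * (b - x)) *
    expR (((b - a) * h)^-1 *
          ((x - a) * ln ((u - a) / (x - a)) + (b - x) * ln ((b - u) / (b - x))))
  else 0.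

Definition kappa (xil hl al bl u : R) : R :=
  if (xil == al) || (xil == bl) then EB xil hl al bl u else EBt xil hl al bl u.

Definition fhat_loo (n d : nat) (a b : 'I_d -> R) (X : 'I_n -> 'I_d -> R)
    (i : 'I_n) (h : 'I_d -> R) : R :=
  (n.-1%:R)^-1 *
  \sum_(j < n | j != i) \prod_(l < d) kappa (X i l) (h l) (a l) (b l) (X j l).

Definition prior (d : nat) (alpha : R) (beta : 'I_d -> R) (h : 'I_d -> R) : R :=
  \prod_(l < d) IG alpha (beta l) (h l).

(** Integration over (0,∞)^k of a function of the first k coordinates of
    h : nat -> R, as an iterated Lebesgue integral (coordinate k-1 outermost).
    Remaining coordinates are taken from h0. *)
Fixpoint iint (k : nat) (F : (nat -> R) -> \bar R) (h0 : nat -> R) : \bar R :=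
  match k with
  | 0 => F h0
  | k'.+1 => (\int[leb]_(t in `]0%R, +oo[)
                 iint k' F (fun m => if m == k' then t else h0 m))%E
  end.

Definition int_pos_orthant (d : nat) (G : ('I_d -> R) -> \bar R) : \bar R :=
  iint d (fun h => G (fun l : 'I_d => h (nat_of_ord l))) (fun _ => 0).

Definition posterior (n d : nat) (a b : 'I_d -> R) (X : 'I_n -> 'I_d -> R)
    (i : 'I_n) (alpha : R) (beta : 'I_d -> R) (h : 'I_d -> R) : R :=
  fhat_loo a b X i h * prior alpha beta h /
  fine (int_pos_orthant (fun g => (fhat_loo a b X i g * prior alpha beta g)%:E)).

Definition post_mean (n d : nat) (a b : 'I_d -> R) (X : 'I_n -> 'I_d -> R)
    (i : 'I_n) (alpha : R) (beta : 'I_d -> R) (m : 'I_d) : \bar R :=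
  int_pos_orthant (fun h => (h m * posterior a b X i alpha beta h)%:E).

(** ----- Quantities of the theorem (x = X_il, y = X_jl, coordinate l) ----- *)

Definition Bq (beta x y a b : R) : R :=
  beta - (b - a)^-1 * ((x - a) * ln ((y - a) / (x - a)) + (b - x) * ln ((b - y) / (b - x))).
Definition Aq (alpha beta x y a b : R) : R :=
  (Num.sqrt (2 * pi * (x - a) * (b - x)))^-1 * beta `^ alpha *
  Gamma (alpha + 2^-1) * Bq beta x y a b `^ (- alpha - 2^-1).
Definition Cq (alpha beta x y a b : R) : R :=
  (Num.sqrt (2 * pi * (x - a) * (b - x)))^-1 * beta `^ alpha *
  Gamma (alpha - 2^-1) * Bq beta x y a b `^ (- alpha + 2^-1).

Definition Eq (beta y a b : R) : R := beta - ln ((b - y) / (b - a)).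
Definition Fq (alpha beta y a b : R) : R :=
  beta `^ alpha * (b - a)^-1 * Gamma alpha * Eq beta y a b `^ (- alpha).
Definition Hq (alpha beta y a b : R) : R :=
  beta `^ alpha * (b - a)^-1 * Gamma (alpha + 1) * Eq beta y a b `^ (- alpha - 1).

Definition Gq (beta y a b : R) : R := beta - ln ((y - a) / (b - a)).
Definition Jq (alpha beta y a b : R) : R :=
  beta `^ alpha * (b - a)^-1 * Gamma alpha * Gq beta y a b `^ (- alpha).
Definition Kq (alpha beta y a b : R) : R :=
  beta `^ alpha * (b - a)^-1 * Gamma (alpha + 1) * Gq beta y a b `^ (- alpha - 1).

Definition Mq (alpha beta x y a b t : R) : R :=
  if x == a then
    Fq alpha beta y a b * IG alpha (Eq beta y a b) t +
    Hq alpha beta y a b * IG (alpha + 1) (Eq beta y a b) t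
  else if x == b then
    Jq alpha beta y a b * IG alpha (Gq beta y a b) t +
    Kq alpha beta y a b * IG (alpha + 1) (Gq beta y a b) t
  else
    Aq alpha beta x y a b * IG (alpha + 2^-1) (Bq beta x y a b) t +
    Cq alpha beta x y a b * IG (alpha - 2^-1) (Bq beta x y a b) t.

Definition wq (alpha beta x y a b : R) : R :=
  if x == a then Fq alpha beta y a b + Hq alpha beta y a b
  else if x == b then Jq alpha beta y a b + Kq alpha beta y a b
  else Aq alpha beta x y a b + Cq alpha beta x y a b.

Definition muq (alpha beta x y a b : R) : R :=
  if x == a then
    Eq beta y a b * (Fq alpha beta y a b / (alpha - 1) + Hq alpha beta y a b / alpha)
  else if x == b then
    Gq beta y a b * (Jq alpha beta y a b / (alpha - 1) + Kq alpha beta y a b / alpha)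
  else
    Bq beta x y a b * (Aq alpha beta x y a b / (alpha - 2^-1) +
                       Cq alpha beta x y a b / (alpha - 3 / 2)).

End Defs.

(* Main.v *)
(* Multiplying the kernel kappa by the inverse gamma prior in one coordinate
   gives, up to the common factor 1 / Gamma alpha, a combination of two inverse
   gamma densities, namely Mq.  The unnormalised posterior is therefore a sum
   over j of products of functions of a single coordinate, so its integral and
   first moments over the orthant factor into one-dimensional integrals.  These
   reduce to the Gamma function by the substitution t -> b / t, and the means
   follow from Gamma (s + 1) = s * Gamma s. *)
Require Import Defs.
From HB Require Import structures.
From mathcomp Require Import all_boot all_order all_algebra.
From mathcomp Require Import all_classical all_reals all_analysis.
From mathcomp Require Import measurable_realfun ring lra.

Import Order.TTheory GRing.Theory Num.Theory.
Import numFieldNormedType.Exports.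
Local Open Scope classical_set_scope.
Local Open Scope ring_scope.

(** * Improper integrals and the inversion substitution on the positive half-line *)

Section positive_half_line.
Set Implicit Arguments.
Unset Strict Implicit.
Context {R : realType}.
Notation mu := (@lebesgue_measure R).
Implicit Types (f : R -> R) (c s t x : R).

Lemma bigcup_itv_gt0 c : 0 < c ->
  \bigcup_n `[c / n.+1%:R, c * n.+1%:R]%classic = `]0, +oo[%classic.
Proof.
move=> c0; apply/seteqP; split => [x [n _]|x] /=.
  rewrite !in_itv/= andbT => /andP[cx _]; apply: lt_le_trans cx.
  by rewrite divr_gt0.
rewrite in_itv/= andbT => x0.
pose n := maxn (Num.truncn (c / x)) (Num.truncn (x / c)).
have nP : c / x <= n.+1%:R /\ x / c <= n.+1%:R.
  split; apply: (le_trans (ltW (truncnS_gt _))); rewrite ler_nat ltnS.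
    exact: leq_maxl.
  exact: leq_maxr.
move: nP; rewrite !ler_pdivrMr// => -[n1 n2]; exists n => //=.
by rewrite in_itv/= ler_pdivrMr// mulrC n1 mulrC n2.
Qed.

(** Monotone convergence, which carries identities on compact intervals over to the half-line. The
    centre [c] is kept free because [t -> c / t] maps [[1 / n.+1, n.+1]] onto
    [[c / n.+1, c * n.+1]]. *)
Lemma cvg_integral_gt0 f c : 0 < c ->
  (forall x, 0 < x -> 0 <= f x) -> measurable_fun (`]0, +oo[%classic : set R) f ->
  (\int[mu]_(x in `[(c / n.+1%:R)%R, (c * n.+1%:R)%R]) (f x)%:E @[n --> \oo] -->
   \int[mu]_(x in `]0%R, +oo[) (f x)%:E)%E.
Proof.
move=> c0 f0 mf; rewrite -(bigcup_itv_gt0 c0).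
have sub n : `[c / n.+1%:R, c * n.+1%:R]%classic `<=` `]0, +oo[%classic.
  by rewrite -(bigcup_itv_gt0 c0) => x nx; exists n.
apply: ge0_nondecreasing_set_cvg_integral => //.
- move=> m n mn; rewrite subsetEset => x /=; rewrite !in_itv/= => /andP[h1 h2].
  apply/andP; split.
    apply: le_trans h1; rewrite ler_pM2l// lef_pV2 ?posrE// ler_nat ltnS//.
  by apply: (le_trans h2); rewrite ler_pM2l// ler_nat ltnS.
- by move=> i; apply/measurable_EFinP; apply: measurable_funS mf => //; exact: sub.
- move=> i x /sub /=; rewrite in_itv/= andbT => x0; rewrite lee_fin; exact: f0.
Qed.

Lemma within_itv_gt0_continuous f (a b : R) : 0 < a ->
  (forall x, 0 < x -> {for x, continuous f}) ->
  {within `[a, b], continuous f}.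
Proof.
move=> a0 cf; apply: continuous_in_subspaceT => x; rewrite inE/= in_itv/= => /andP[ax _].
by apply: cf; exact: lt_le_trans ax.
Qed.

Lemma derivable_continuous_gt0 f :
  (forall x, 0 < x -> derivable f x 1) ->
  (forall x, 0 < x -> {for x, continuous f}).
Proof.
by move=> df x x0; apply/differentiable_continuous/derivable1_diffP; exact: df.
Qed.

Lemma derivable_oo_LRcontinuous_gt0 f (a b : R) : 0 < a -> a < b ->
  (forall x, 0 < x -> derivable f x 1) -> derivable_oo_LRcontinuous f a b.
Proof.
move=> a0 ab df; have b0 := lt_trans a0 ab; split.
- by move=> x; rewrite in_itv/= => /andP[ax _]; apply: df; exact: lt_trans ax.
- by apply: cvg_at_right_filter; exact: (derivable_continuous_gt0 df).
- by apply: cvg_at_left_filter; exact: (derivable_continuous_gt0 df).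
Qed.

Lemma measurable_gt0_continuous f :
  (forall x, 0 < x -> {for x, continuous f}) ->
  measurable_fun (`]0, +oo[%classic : set R) f.
Proof.
move=> cf; apply: open_continuous_measurable_fun; first exact: interval_open.
by move=> x; rewrite inE/= in_itv/= andbT; exact: cf.
Qed.

Lemma powR_continuous_gt0 s x : 0 < x -> {for x, continuous (fun t => t `^ s)}.
Proof.
move=> x0; apply: derivable_continuous_gt0 => // y y0.
by apply: derivable_powR; rewrite in_itv/= y0.
Qed.

Lemma is_derive_scaled_inv c x : 0 < x ->
  is_derive x 1 (fun t => c / t) (- (c / x ^+ 2)).
Proof.
move=> x0.
have h : is_derive x 1 (fun t : R => t^-1) (- x ^- 2 *: 1).
  by apply: (@is_deriveV _ id) => //; rewrite gt_eqF.
have := is_deriveZ c h.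
by rewrite /GRing.scale/= mulr1 mulrN.
Qed.

(** The decreasing substitution [t -> c / t] is made on compact intervals away from 0; both sides
    then pass to the limit along matching exhaustions. *)
Lemma ge0_integral_inv_subst f c : 0 < c ->
  (forall x, 0 < x -> 0 <= f x) ->
  (forall x, 0 < x -> {for x, continuous f}) ->
  (\int[mu]_(x in `]0%R, +oo[) (f x)%:E =
   \int[mu]_(x in `]0%R, +oo[) (f (c / x) * (c / x ^+ 2))%:E)%E.
Proof.
move=> c0 f0 cf.
have dinv x : 0 < x -> derivable (fun t => c / t) x 1.
  by move=> x0; have [] := is_derive_scaled_inv c x0.
have derE x : 0 < x -> derive1 (fun t => c / t) x = - (c / x ^+ 2).
  by move=> x0; have [_ <-] := is_derive_scaled_inv c x0; rewrite derive1E.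
have cder x : 0 < x -> {for x, continuous (fun t : R => c / t ^+ 2)}.
  move=> x0; apply: continuousM; first exact: cst_continuous.
  apply: continuousV; first by rewrite sqrf_eq0 gt_eqF.
  exact: exprn_continuous.
have cder' x : 0 < x -> {for x, continuous (derive1 (fun t => c / t))}.
  move=> x0; rewrite /prop_for/continuous_at derE//.
  (* The closed form of the derivative is available at positive points only, so it is substituted on
     a neighbourhood of [x] that stays positive. *)
  apply: (@cvg_trans _ (- (c / y ^+ 2) @[y --> x])).
    apply: near_eq_cvg; near=> y; rewrite derE//.
    by near: y; exact: lt_nbhsr.
  exact: (cvgN (cder _ x0)).
have cg x : 0 < x -> {for x, continuous (fun x => f (c / x) * (c / x ^+ 2))}.
  move=> x0; apply: continuousM; last exact: cder.
  apply: (@continuous_comp _ _ _ (fun t => c / t) f).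
    exact: (derivable_continuous_gt0 dinv).
  by apply: cf; exact: divr_gt0.
have H1 := cvg_integral_gt0 c0 f0 (measurable_gt0_continuous cf).
have H2 := @cvg_integral_gt0 (fun x => f (c / x) * (c / x ^+ 2)) 1 ltr01
  (fun x (px : 0 < x) => mulr_ge0 (f0 _ (divr_gt0 c0 px))
                 (divr_ge0 (ltW c0) (exprn_ge0 2 (ltW px))))
  (measurable_gt0_continuous cg).
apply: (cvg_unique _ H1); first exact: ereal_hausdorff.
apply: cvg_trans H2; apply: near_eq_cvg; near=> n.
have n0 : 0 < n.+1%:R^-1 :> R by rewrite invr_gt0.
have nn : n.+1%:R^-1 <= n.+1%:R :> R.
  by rewrite invf_ple ?posrE// (@le_trans _ _ 1) ?ler1n// invf_le1 ?ler1n.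
have := @integration_by_substitution_decreasing R (fun t => c / t) f
  (n.+1%:R^-1) n.+1%:R nn.
rewrite invrK !mul1r => -> //.
- apply: eq_integral => x; rewrite inE/= in_itv/= => /andP[nx _].
  by rewrite !fctE/= derE ?opprK//; exact: lt_le_trans nx.
- move=> x y; rewrite !in_itv/= => /andP[hx _] /andP[hy _] xy.
  rewrite ltr_pM2l// ltf_pV2// posrE; exact: lt_le_trans n0 _.
- by move=> x; rewrite in_itv/= => /andP[nx _]; apply: cder'; exact: lt_trans nx.
- by apply: (cvgP (derive1 (fun t => c / t) n.+1%:R^-1)); apply: cvg_at_right_filter; exact: cder'.
- by apply: (cvgP (derive1 (fun t => c / t) n.+1%:R)); apply: cvg_at_left_filter; exact: cder'.
- split.
  + by move=> x; rewrite in_itv/= => /andP[ax _]; apply: dinv; exact: lt_trans ax.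
  + by apply: cvg_at_right_filter; exact: (derivable_continuous_gt0 dinv).
  + by apply: cvg_at_left_filter; exact: (derivable_continuous_gt0 dinv).
- apply: within_itv_gt0_continuous => //; exact: divr_gt0.
Unshelve. all: by end_near. Qed.

End positive_half_line.

(** * The Gamma function and the unnormalised inverse gamma integral *)

Section gamma.
Set Implicit Arguments.
Unset Strict Implicit.
Context {R : realType}.
Notation mu := (@lebesgue_measure R).
Implicit Types (s t b : R).

Lemma ln_le_subr1 t : 0 < t -> ln t <= t - 1.
Proof.
by move=> t0; have := @le_ln1Dx R (t - 1); rewrite [1 + _]addrC subrK; apply; lra.
Qed.

Lemma powR_mul_expR_le s : 0 < s -> exists2 C : R, 0 < C &
  forall t, 0 < t -> t `^ s * expR (- t) <= C * expR (- (t / 2)).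
Proof.
(* C = (2 s) `^ s comes from ln u <= u - 1 at u = t / (2 s). *)
move=> s0; exists (expR (s * ln (2 * s))); first exact: expR_gt0.
move=> t t0; have s20 : 0 < 2 * s by lra.
have := ln_le_subr1 (divr_gt0 t0 s20).
rewrite ln_div ?posrE// => /(ler_wpM2l (ltW s0)).
rewrite (_ : s * (t / (2 * s) - 1) = t / 2 - s); last by field; rewrite gt_eqF.
move=> h; rewrite /powR gt_eqF// -!expRD ler_expR; lra.
Qed.

Lemma gamma_integrand_continuous s t : 0 < t ->
  {for t, continuous (fun t => t `^ s * expR (- t))}.
Proof.
move=> t0; apply: continuousM; first exact: powR_continuous_gt0.
apply: (@continuous_comp _ _ _ -%R expR); last exact: continuous_expR.
exact: opp_continuous.
Qed.

(** The integrand is twice the exponential density of rate 1/2. *)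
Lemma integrable_expR_half :
  mu.-integrable `]0%R, +oo[ (EFin \o (fun t => expR (- (t / 2)))).
Proof.
have h2 : (0 : R) < 2^-1 by rewrite invr_gt0.
have h : mu.-integrable `]0%R, +oo[ (EFin \o exponential_pdf (2^-1 : R)).
  by apply: integrableS (integrable_exponential_pdf h2) => //; exact: measurable_itv.
apply: eq_integrable (integrableZl _ 2 h) => //.
move=> t; rewrite inE/= in_itv/= andbT => t0.
rewrite exponential_pdfE ?ltW// -EFinM mulrA divff ?mul1r//.
by rewrite mulNr [t / 2]mulrC.
Qed.

(** Dominated by a multiple of [expR (- (t / 2))]. This covers positive exponents only; exponents in
    (-1, 0] are reached later through integration by parts. *)
Lemma integrable_gammaS s : 0 < s ->
  mu.-integrable `]0%R, +oo[ (EFin \o (fun t => t `^ s * expR (- t))).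
Proof.
move=> s0; have [C C0 HC] := powR_mul_expR_le s0.
apply: le_integrable (integrableZl _ C integrable_expR_half) => //.
  apply/measurable_EFinP; apply: measurable_gt0_continuous => t t0.
  exact: gamma_integrand_continuous.
move=> t /=; rewrite in_itv/= andbT => t0.
rewrite lee_fin !ger0_norm ?HC// mulr_ge0 ?expR_ge0 ?powR_ge0// ltW//.
Qed.

(** Integration by parts on [[1 / n.+1, n.+1]], with boundary terms tending to 0. Stated in the
    extended reals, the identity does not presuppose that the right side is finite and can serve to
    prove it. *)
Lemma integral_gamma_by_parts s : 0 < s ->
  (\int[mu]_(t in `]0%R, +oo[) (t `^ s * expR (- t))%:E =
   \int[mu]_(t in `]0%R, +oo[) (s * (t `^ (s - 1) * expR (- t)))%:E)%E.
Proof.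
move=> s0.
pose f t := t `^ s * expR (- t); pose g t := s * (t `^ (s - 1) * expR (- t)).
have f0 t : 0 < t -> 0 <= f t by move=> _; rewrite mulr_ge0 ?expR_ge0 ?powR_ge0.
have g0 t : 0 < t -> 0 <= g t.
  by move=> _; rewrite !mulr_ge0 ?expR_ge0 ?powR_ge0 ?ltW.
have cf t : 0 < t -> {for t, continuous f}.
  by move=> t0; exact: gamma_integrand_continuous.
have cg t : 0 < t -> {for t, continuous g}.
  move=> t0; apply: continuousM; first exact: cst_continuous.
  exact: gamma_integrand_continuous.
have Hf := cvg_integral_gt0 ltr01 f0 (measurable_gt0_continuous cf).
have Hg := cvg_integral_gt0 ltr01 g0 (measurable_gt0_continuous cg).
have dexp t : is_derive t 1 (fun t => - expR (- t)) (expR (- t)).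
  apply: is_derive_eq; rewrite /GRing.scale/=; ring.
have dpow t : 0 < t -> is_derive t 1 (fun t => t `^ s) (s * t `^ (s - 1)).
  exact: is_derive1_powR.
have ibp (a b : R) : 0 < a -> a < b ->
    (\int[mu]_(t in `[a, b]) (f t)%:E =
     (f a - f b)%:E + \int[mu]_(t in `[a, b]) (g t)%:E)%E.
  move=> a0 ab.
  have cst : forall t, 0 < t -> {for t, continuous (fun t => s * t `^ (s - 1))}.
    move=> t t0; apply: continuousM; first exact: cst_continuous.
    exact: powR_continuous_gt0.
  have cexp : continuous (fun t : R => expR (- t)).
    move=> t; apply: (@continuous_comp _ _ _ -%R expR).
      exact: opp_continuous.
    exact: continuous_expR.
  have := @integration_by_parts R (fun t => t `^ s) (fun t => - expR (- t))
    (fun t => s * t `^ (s - 1)) (fun t => expR (- t)) a b ab.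
  move=> ->.
  - congr (_ + _)%E; first by rewrite /f; congr EFin; ring.
    (* The sign comes from the antiderivative [- expR (- t)]; moving it through the integral is
       justified by integrability on a compact interval. *)
    rewrite -integralN/=; last first.
      apply: integrable_add_def.
        exact: measurable_itv.
      apply: continuous_compact_integrable; first exact: segment_compact.
      apply: within_itv_gt0_continuous => // t t0.
      by apply: continuousM; [exact: cst|apply: continuousN; exact: cexp].
    by apply: eq_integral => t _; rewrite /g /= -?EFinN; congr EFin; ring.
  - exact: within_itv_gt0_continuous.
  - by apply: derivable_oo_LRcontinuous_gt0 => // t t0; have [] := dpow t t0.
  - move=> t; rewrite in_itv/= => /andP[at0 _]; rewrite derive1E.
    by have [_ ->] := dpow t (lt_trans a0 at0).
  - exact: continuous_subspaceT.
  - by apply: derivable_oo_LRcontinuous_gt0 => // t t0; have [] := dexp t.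
  - by move=> t _; rewrite derive1E; have [_ ->] := dexp t.
(* The boundary term of the integration by parts. *)
pose u n := f (1 / n.+1%:R) - f (1 * n.+1%:R).
have u0 : u n @[n --> \oo] --> (0 : R).
  rewrite -[0 : R]subr0; apply: cvgB.
    (* At the lower end [f t <= t ^ s], which vanishes as [t] tends to 0 because [s] is positive. *)
    apply: (@squeeze_cvgr _ _ _ _ (fun=> 0) (fun n => (harmonic n) `^ s)).
    - near=> n; rewrite f0 ?divr_gt0//= /f mul1r ler_piMr ?powR_ge0//.
    - exact: cvg_cst.
    - apply: ((cvg_at_rightP _ _ _).1 (powR_cvg0 s0) (@harmonic R)).
      by split; [exact: harmonic_gt0|exact: cvg_harmonic].
  (* At the upper end [f t <= C * expR (- (t / 2)) <= 2 * C / t], the last bound coming from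
     [1 + t / 2 <= expR (t / 2)]. *)
  have [C C0 HC] := powR_mul_expR_le s0.
  apply: (@squeeze_cvgr _ _ _ _ (fun=> 0) (fun n => 2 * C * harmonic n)).
  - near=> n; rewrite mul1r f0//= (le_trans (HC _ _))//.
    have n20 : (0 : R) < n.+1%:R / 2 by rewrite divr_gt0.
    rewrite [2 * C]mulrC -mulrA (_ : 2 * _ = (n.+1%:R / 2)^-1); last first.
      by rewrite invfM invrK mulrC.
    rewrite ler_pM2l// expRN lef_pV2 ?posrE ?expR_gt0//.
    by rewrite (le_trans _ (expR_ge1Dx _))// lerDr.
  - exact: cvg_cst.
  - by rewrite -[0 : R](mulr0 (2 * C)); apply: cvgMr; exact: cvg_harmonic.
have uE : (fun n => (u n)%:E) n @[n --> \oo] --> (0 : \bar R).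
  by apply: cvg_EFin u0; near=> n.
have Hug : ((u n)%:E + \int[mu]_(x in `[(1 / n.+1%:R)%R, (1 * n.+1%:R)%R])
    (g x)%:E)%E @[n --> \oo] --> (\int[mu]_(x in `]0%R, +oo[) (g x)%:E)%E.
  by rewrite -[X in _ --> X]add0e; exact: cvgeD.
apply: (cvg_unique _ Hf); first exact: ereal_hausdorff.
apply: cvg_trans Hug; apply: near_eq_cvg; near=> n.
rewrite /= -ibp//.
(* [ibp] needs a nondegenerate interval, which excludes [n = 0]. *)
rewrite !mul1r invf_plt ?posrE// (@lt_trans _ _ 1)//.
  by rewrite invf_lt1 ?ltr1n//; near: n; exists 1%N.
by rewrite ltr1n; near: n; exists 1%N.
Unshelve. all: by end_near. Qed.

(** For [s < 1] the integrand is unbounded at 0; integration by parts equates [s] times its integral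
    with the integral of [t ^ s * expR (- t)], already known to be finite. *)
Lemma integrable_gamma s : 0 < s ->
  mu.-integrable `]0%R, +oo[ (EFin \o (fun t => t `^ (s - 1) * expR (- t))).
Proof.
move=> s0.
have ms : measurable_fun (`]0, +oo[%classic : set R)
    (fun t => t `^ (s - 1) * expR (- t)).
  by apply: measurable_gt0_continuous => t t0; exact: gamma_integrand_continuous.
suff h : mu.-integrable `]0%R, +oo[
    (EFin \o (fun t => s * (t `^ (s - 1) * expR (- t)))).
  apply: eq_integrable (integrableZl _ s^-1 h) => // t _ /=.
  by rewrite -EFinM mulKf// gt_eqF.
apply/integrableP; split.
  by apply/measurable_EFinP; apply: measurable_funM => //; exact: measurable_cst.
under eq_integral.
  move=> t _ /=; rewrite ger0_norm; last first.
    by rewrite !mulr_ge0 ?expR_ge0 ?powR_ge0 ?ltW.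
  over.
rewrite /= -integral_gamma_by_parts//.
by rewrite ltey_eq integrable_fin_num//; exact: integrable_gammaS.
Qed.

Lemma integral_gammaE s : 0 < s ->
  (\int[mu]_(t in `]0%R, +oo[) (t `^ (s - 1) * expR (- t))%:E = (Gamma s)%:E)%E.
Proof.
by move=> s0; rewrite /Gamma /Rintegral fineK// integrable_fin_num//;
  exact: integrable_gamma.
Qed.

Lemma GammaS s : 0 < s -> Gamma (s + 1) = s * Gamma s.
Proof.
move=> s0; apply: EFin_inj; rewrite -integral_gammaE; last lra.
rewrite addrK integral_gamma_by_parts// EFinM -integral_gammaE//.
by rewrite -integralZl//; exact: integrable_gamma.
Qed.

(** The nonnegative integrand is at least a positive constant on [[1, 2]]. *)
Lemma Gamma_gt0 s : 0 < s -> 0 < Gamma s.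
Proof.
move=> s0; rewrite -lte_fin -integral_gammaE//.
(* On [[1, 2]] both [ln t] and [t] are at most 2, so [(s - 1) * ln t - t] is at least the exponent
   chosen here. *)
pose c : R := expR (- (2 * `|s - 1| + 2)).
have ms : measurable_fun (`]0, +oo[%classic : set R)
    (fun t => t `^ (s - 1) * expR (- t)).
  by apply: measurable_gt0_continuous => t t0; exact: gamma_integrand_continuous.
have sub : (`[1, 2]%classic : set R) `<=` `]0, +oo[%classic.
  by move=> t /=; rewrite !in_itv/= andbT => /andP[t1 _]; exact: lt_le_trans t1.
apply: (@lt_le_trans _ _ (\int[mu]_(t in `[1%R, 2%R]) c%:E)%E).
  rewrite integral_cst//= lebesgue_measure_itv/= lte_fin ltr1n/=.
  by rewrite mule_gt0// lte_fin ?expR_gt0//; lra.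
apply: (@le_trans _ _ (\int[mu]_(t in `[1%R, 2%R]) (t `^ (s - 1) * expR (- t))%:E)%E).
  apply: ge0_le_integral => //.
  - by move=> t _; rewrite lee_fin expR_ge0.
  - by apply/measurable_EFinP; exact: measurable_funS ms.
  - move=> t /=; rewrite in_itv/= => /andP[t1 t2].
    rewrite lee_fin /powR gt_eqF; last by lra.
    rewrite -expRD ler_expR.
    have l0 : 0 <= ln t by exact: ln_ge0.
    have l2 : ln t <= 2 by apply: le_trans t2; apply/ltW/ln_sublinear; lra.
    have : `|(s - 1) * ln t| <= `|s - 1| * 2.
      by rewrite normrM ler_wpM2l// ger0_norm.
    by rewrite ler_norml => /andP[h _]; lra.
apply: ge0_subset_integral => //.
- exact/measurable_EFinP.
- by move=> t _; rewrite lee_fin mulr_ge0 ?expR_ge0 ?powR_ge0.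
Qed.

(** The substitution [t -> b / t] in the integral defining [Gamma s]. *)
Lemma integral_inv_gamma s b : 0 < s -> 0 < b ->
  (\int[mu]_(t in `]0%R, +oo[) (t `^ (- s - 1) * expR (- (b / t)))%:E =
   (Gamma s * b `^ (- s))%:E)%E.
Proof.
move=> s0 b0; rewrite mulrC EFinM -integral_gammaE// -integralZl//; last first.
  exact: integrable_gamma.
have f0 t : 0 < t -> 0 <= b `^ (- s) * (t `^ (s - 1) * expR (- t)).
  by move=> _; rewrite !mulr_ge0 ?expR_ge0 ?powR_ge0.
have cf t : 0 < t ->
    {for t, continuous (fun t => b `^ (- s) * (t `^ (s - 1) * expR (- t)))}.
  move=> t0; apply: continuousM; first exact: cst_continuous.
  exact: gamma_integrand_continuous.
under [RHS]eq_integral do rewrite -EFinM.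
rewrite (ge0_integral_inv_subst b0 f0 cf).
apply: eq_integral => t; rewrite inE/= in_itv/= andbT => t0; congr EFin.
have t1 : t != 0 by rewrite gt_eqF.
have b1 : b != 0 by rewrite gt_eqF.
(* The powers of [b] cancel, since [- s + (s - 1) + 1 = 0], and those of [t] add up to
   [- (s - 1) - 2 = - s - 1]. *)
suff <- : b `^ (- s) * (b / t) `^ (s - 1) * (b / t ^+ 2) = t `^ (- s - 1) by ring.
have -> : b / t ^+ 2 = b `^ 1 * t `^ (- 2%:R).
  by rewrite powRr1 ?ltW// powR_invn// ltW.
rewrite powRM ?invr_ge0 ?ltW// -[t^-1]powR_inv1 ?ltW// -powRrM.
rewrite (_ : b `^ (- s) * _ * _ =
  (b `^ (- s) * b `^ (s - 1) * b `^ 1) * (t `^ (-1 * (s - 1)) * t `^ (- 2%:R))).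
  rewrite -!powRD ?b1 ?t1 ?implybT// (_ : - s + (s - 1) + 1 = 0); last by ring.
  by rewrite powRr0 mul1r; congr powR; ring.
by ring.
Qed.

Lemma integrable_inv_gamma s b : 0 < s -> 0 < b ->
  mu.-integrable `]0%R, +oo[
    (EFin \o (fun t => t `^ (- s - 1) * expR (- (b / t)))).
Proof.
move=> s0 b0; apply/integrableP; split.
  apply/measurable_EFinP; apply: measurable_gt0_continuous => t t0.
  apply: continuousM; first exact: powR_continuous_gt0.
  apply: (@continuous_comp _ _ _ (fun t => - (b / t)) expR); last first.
    exact: continuous_expR.
  apply: continuousN; apply: continuousM; first exact: cst_continuous.
  by apply: inv_continuous; rewrite gt_eqF.
under eq_integral.
  move=> t _ /=; rewrite ger0_norm; last by rewrite mulr_ge0 ?expR_ge0 ?powR_ge0.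
  over.
by rewrite /= integral_inv_gamma// ltry.
Qed.

End gamma.

(** * The Beta function with one argument equal to 1 *)

Section beta.
Set Implicit Arguments.
Unset Strict Implicit.
Context {R : realType}.
Notation mu := (@lebesgue_measure R).
Implicit Types (p q : R).

Lemma powR_within_continuous01 p : 0 < p ->
  {within `[0, 1], continuous (fun t : R => t `^ p)}.
Proof.
move=> p0; apply/continuous_within_itvP; first exact: ltr01.
split.
- by move=> x; rewrite in_itv/= => /andP[x0 _]; exact: powR_continuous_gt0.
- by rewrite powR0 ?gt_eqF//; exact: powR_cvg0.
- by apply: cvg_at_left_filter; exact: powR_continuous_gt0.
Qed.

(** The condition [1 < p] makes the integrand continuous up to 0, as the fundamental theorem
    requires. It holds in the application, where [p] is [1 + h^-1]. *)
Lemma Rintegral_powR01 p : 1 < p ->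
  (\int[mu]_(t in `[0, 1]) (t `^ (p - 1)))%R = p^-1.
Proof.
move=> p1; have p0 : 0 < p by lra.
rewrite /Rintegral (@continuous_FTC2 _ _ (fun t => p^-1 * t `^ p)).
- by rewrite powR1 powR0 ?gt_eqF// mulr1 mulr0 -EFinB subr0.
- exact: ltr01.
- by apply: powR_within_continuous01; lra.
- have d x : 0 < x -> derivable (fun t => p^-1 * t `^ p) x 1.
    by move=> x0; apply: derivableM => //; apply: derivable_powR; rewrite in_itv/= x0.
  split.
  + by move=> x; rewrite in_itv/= => /andP[x0 _]; exact: d.
  + rewrite powR0 ?gt_eqF//; apply: cvgMr; exact: powR_cvg0.
  + by apply: cvg_at_left_filter; exact: (derivable_continuous_gt0 d ltr01).
- move=> x; rewrite in_itv/= => /andP[x0 _].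
  have h : is_derive x 1 (fun t => t `^ p) (p * x `^ (p - 1)).
    exact: is_derive1_powR.
  have [_] := is_deriveZ p^-1 h; rewrite derive1E => ->.
  by rewrite /GRing.scale/= mulKf// gt_eqF.
Qed.

Lemma Betar1 p : 1 < p -> Beta p 1 = p^-1.
Proof.
move=> p1; rewrite -Rintegral_powR01//; apply: eq_Rintegral => t _.
(* The factor [(1 - t) ^ 0] is 1 even at [t = 1], by the convention for [powR]. *)
by rewrite subrr powRr0 mulr1.
Qed.

(** Reduced to the power integral by the reflection [t -> 1 - t]. *)
Lemma Beta1r q : 1 < q -> Beta 1 q = q^-1.
Proof.
move=> q1; rewrite -Rintegral_powR01//.
rewrite (@Rintegration_by_substitution_onem _ (fun t => t `^ (q - 1)) 1); last 2 first.
- by rewrite ler01 lexx.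
- by apply: powR_within_continuous01; lra.
rewrite unstable.onem1; apply: eq_Rintegral => t _.
by rewrite subrr powRr0 mul1r.
Qed.

End beta.

(** * Mass and mean of inverse gamma densities *)

Section inverse_gamma.
Set Implicit Arguments.
Unset Strict Implicit.
Context {R : realType}.
Notation mu := (@lebesgue_measure R).
Implicit Types (f g : R -> R) (s b c t v w : R).

(** Integrability and value travel together, so linear combinations and finite sums carry no sign or
    finiteness conditions. *)
Definition has_integral f v : Prop :=
  mu.-integrable `]0%R, +oo[ (EFin \o f) /\
  (\int[mu]_(t in `]0%R, +oo[) (f t)%:E = v%:E)%E.

Lemma has_integralZ c f v : has_integral f v ->
  has_integral (fun t => c * f t) (c * v).
Proof.
move=> [fi fv]; split.
  by apply: eq_integrable (integrableZl _ c fi) => // t _ /=; rewrite EFinM.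
by rewrite EFinM -fv -integralZl.
Qed.

Lemma has_integralD f g v w : has_integral f v -> has_integral g w ->
  has_integral (fun t => f t + g t) (v + w).
Proof.
move=> [fi fv] [gi gw]; split.
  by apply: eq_integrable (integrableD _ fi gi) => // t _ /=; rewrite EFinD.
by rewrite EFinD -fv -gw -integralD.
Qed.

Lemma eq_has_integral f g v : (forall t, 0 < t -> f t = g t) ->
  has_integral f v -> has_integral g v.
Proof.
move=> fg [fi fv]; have fgE t : t \in `]0%R, +oo[%classic -> (f t)%:E = (g t)%:E.
  by rewrite inE/= in_itv/= andbT => /fg ->.
split; first exact: eq_integrable fi.
by rewrite -fv; apply: eq_integral => t th; rewrite fgE.
Qed.

Lemma has_integral_sum (I : Type) (r : seq I) (P : pred I) (f : I -> R -> R)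
    (v : I -> R) : (forall i, P i -> has_integral (f i) (v i)) ->
  has_integral (fun t => \sum_(i <- r | P i) f i t) (\sum_(i <- r | P i) v i).
Proof.
move=> fv; elim: r => [|i r ih].
  rewrite big_nil; under eq_fun do rewrite big_nil.
  split; first exact: integrable0.
  by rewrite integral0.
rewrite big_cons; under eq_fun do rewrite big_cons.
by case: ifPn => // Pi; apply: has_integralD => //; exact: fv.
Qed.

Lemma has_integral_IG s b : 0 < s -> 0 < b -> has_integral (IG s b) 1.
Proof.
move=> s0 b0.
have h : has_integral (fun t => t `^ (- s - 1) * expR (- (b / t)))
    (Gamma s * b `^ (- s)).
  by split; [exact: integrable_inv_gamma|exact: integral_inv_gamma].
have := has_integralZ (b `^ s / Gamma s) h.
have -> : b `^ s / Gamma s * (Gamma s * b `^ (- s)) = 1.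
  have G0 : Gamma s != 0 by rewrite gt_eqF// Gamma_gt0.
  by rewrite powRN; field; rewrite G0 gt_eqF ?powR_gt0.
by apply: eq_has_integral => t t0; rewrite /IG t0 mulrA.
Qed.

(** Multiplying by [t] lowers the shape by one, and [Gamma s = (s - 1) * Gamma (s - 1)] gives the
    ratio of the normalising constants. Means thus reduce to total masses. *)
Lemma IG_size_bias s b t : 1 < s -> 0 < b ->
  t * IG s b t = b / (s - 1) * IG (s - 1) b t.
Proof.
move=> s1 b0; rewrite /IG; case: ifPn => [t0|_]; last by rewrite !mulr0.
have s10 : 0 < s - 1 by lra.
have GE : Gamma s = (s - 1) * Gamma (s - 1) by rewrite -GammaS// subrK.
have bE : b `^ s = b `^ (s - 1) * b.
  by rewrite -{3}(powRr1 (ltW b0)) -powRD ?subrK// (gt_eqF b0) implybT.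
have tE : t `^ (- (s - 1) - 1) = t `^ (- s - 1) * t.
  rewrite -{3}(powRr1 (ltW t0)) -powRD ?(gt_eqF t0) ?implybT//.
  by congr powR; ring.
rewrite bE tE GE.
have G0 : Gamma (s - 1) != 0 by rewrite gt_eqF// Gamma_gt0.
by field; rewrite G0 gt_eqF.
Qed.

Lemma has_integral_IG_mean s b : 1 < s -> 0 < b ->
  has_integral (fun t => t * IG s b t) (b / (s - 1)).
Proof.
move=> s1 b0; have h : has_integral (IG (s - 1) b) 1.
  by apply: has_integral_IG => //; lra.
have := has_integralZ (b / (s - 1)) h; rewrite mulr1.
by apply: eq_has_integral => t _; rewrite IG_size_bias.
Qed.

(** Strips the normalising constant: the coefficients in [Mq] contain exactly the factor
    [Gamma s * b ^ (- s)] that cancels it. *)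
Lemma Gamma_powR_IG s b t : 0 < s -> 0 < b -> 0 < t ->
  Gamma s * b `^ (- s) * IG s b t = t `^ (- s - 1) * expR (- (b / t)).
Proof.
move=> s0 b0 t0; have G0 : Gamma s != 0 by rewrite gt_eqF// Gamma_gt0.
by rewrite /IG t0 powRN; field; rewrite G0 !gt_eqF ?powR_gt0.
Qed.

End inverse_gamma.

(** * The kernel times the prior in a single coordinate *)

Section kernels.
Set Implicit Arguments.
Unset Strict Implicit.
Context {R : realType}.
Implicit Types (alpha beta x y a b t : R).

Lemma Eq_gt0 beta y a b : 0 < beta -> a < y < b -> 0 < Eq beta y a b.
Proof.
move=> b0 /andP[ay yb]; rewrite /Eq subr_gt0 (le_lt_trans _ b0)//.
by rewrite ln_le0// ler_pdivrMr; lra.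
Qed.

Lemma Gq_gt0 beta y a b : 0 < beta -> a < y < b -> 0 < Gq beta y a b.
Proof.
move=> b0 /andP[ay yb]; rewrite /Gq subr_gt0 (le_lt_trans _ b0)//.
by rewrite ln_le0// ler_pdivrMr; lra.
Qed.

(** The bracket is nonpositive, a form of the Gibbs inequality: bounding both logarithms by
    [ln u <= u - 1] leaves [y - x] and [x - y], which cancel. *)
Lemma Bq_gt0 beta x y a b : 0 < beta -> a < x < b -> a < y < b ->
  0 < Bq beta x y a b.
Proof.
move=> b0 /andP[ax xb] /andP[ay yb]; rewrite /Bq subr_gt0 (le_lt_trans _ b0)//.
rewrite pmulr_rle0 ?invr_gt0; last by lra.
have xa0 : 0 < x - a by lra.
have bx0 : 0 < b - x by lra.
have ya0 : 0 < y - a by lra.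
have by0 : 0 < b - y by lra.
have := ler_wpM2l (ltW xa0) (ln_le_subr1 (divr_gt0 ya0 xa0)).
have := ler_wpM2l (ltW bx0) (ln_le_subr1 (divr_gt0 by0 bx0)).
have -> : (b - x) * ((b - y) / (b - x) - 1) = x - y by field; rewrite gt_eqF.
have -> : (x - a) * ((y - a) / (x - a) - 1) = y - x by field; rewrite gt_eqF.
by move=> *; lra.
Qed.

(** At the left endpoint one power has exponent 0 and [Beta 1 (1 + t^-1)] is the inverse of
    [1 + t^-1]. The remaining power is written as an exponential in [1 / t], ready to merge with
    that of [IG]. *)
Lemma EB_left t a b y : 0 < t -> a < y < b ->
  EB a t a b y = (1 + t^-1) * (b - a)^-1 * expR (ln ((b - y) / (b - a)) / t).
Proof.
move=> t0 /andP[ay yb]; have ba : 0 < b - a by lra.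
have by0 : 0 < b - y by lra.
have t1 : t != 0 by rewrite gt_eqF.
have ba1 : b - a != 0 by rewrite gt_eqF.
rewrite /EB (ltW ay) (ltW yb)/= subrr mul0r powRr0 mul1r addr0.
have -> : (b - a) / ((b - a) * t) = t^-1 by field; rewrite t1.
have ti : 0 < t^-1 by rewrite invr_gt0.
rewrite Beta1r; last by lra.
rewrite powRD ?ba1 ?implybT// powRr1 ?ltW// ln_div ?posrE//.
rewrite [(ln _ - _) / t]mulrBl expRB /powR !gt_eqF// ![ln _ / t]mulrC.
have e0 : expR (t^-1 * ln (b - a)) != 0 by rewrite gt_eqF// expR_gt0.
by field; rewrite t1 ba1 e0 gt_eqF//; lra.
Qed.

Lemma EB_right t a b y : 0 < t -> a < y < b ->
  EB b t a b y = (1 + t^-1) * (b - a)^-1 * expR (ln ((y - a) / (b - a)) / t).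
Proof.
move=> t0 /andP[ay yb]; have ba : 0 < b - a by lra.
have ya0 : 0 < y - a by lra.
have t1 : t != 0 by rewrite gt_eqF.
have ba1 : b - a != 0 by rewrite gt_eqF.
rewrite /EB (ltW ay) (ltW yb)/= subrr mul0r powRr0 mulr1 addr0.
have -> : (b - a) / ((b - a) * t) = t^-1 by field; rewrite t1.
have ti : 0 < t^-1 by rewrite invr_gt0.
rewrite Betar1; last by lra.
rewrite powRD ?ba1 ?implybT// powRr1 ?ltW// ln_div ?posrE//.
rewrite [(ln _ - _) / t]mulrBl expRB /powR !gt_eqF// ![ln _ / t]mulrC.
have e0 : expR (t^-1 * ln (b - a)) != 0 by rewrite gt_eqF// expR_gt0.
by field; rewrite t1 ba1 e0 gt_eqF//; lra.
Qed.

Lemma powRD1 t p q : 0 < t -> p = q + 1 -> t `^ p = t `^ q * t.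
Proof.
move=> t0 ->; rewrite powRD; last by rewrite (gt_eqF t0) implybT.
by rewrite powRr1// ltW.
Qed.

(** The exponential shifts the rate from [beta] to [beta - L], and the two terms of [1 + t^-1] yield
    the shapes [alpha] and [alpha + 1]. Abstracting the logarithm as [L] serves both endpoints. *)
Lemma kernel_edge_mul_IG alpha beta c L t : 0 < alpha -> 0 < t -> 0 < beta - L ->
  (1 + t^-1) * c * expR (L / t) * IG alpha beta t =
  (Gamma alpha)^-1 *
  (beta `^ alpha * c * Gamma alpha * (beta - L) `^ (- alpha) *
     IG alpha (beta - L) t +
   beta `^ alpha * c * Gamma (alpha + 1) * (beta - L) `^ (- alpha - 1) *
     IG (alpha + 1) (beta - L) t).
Proof.
move=> a0 t0 E0; have t1 : t != 0 by rewrite gt_eqF.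
have h1 := Gamma_powR_IG a0 E0 t0.
have a1 : 0 < alpha + 1 by lra.
have h2 := Gamma_powR_IG a1 E0 t0; rewrite opprD in h2.
rewrite -!mulrA !(mulrA (Gamma _)) h1 h2 (powRD1 (p := - alpha - 1) (q := - alpha - 1 - 1) t0); last by ring.
rewrite {1}/IG t0 (powRD1 (p := - alpha - 1) (q := - alpha - 1 - 1) t0); last by ring.
rewrite mulrBl opprB expRD expRN.
have G0 : Gamma alpha != 0 by rewrite gt_eqF// Gamma_gt0.
by field; rewrite G0 t1 gt_eqF ?expR_gt0.
Qed.

(** Conjugacy in one coordinate. In the interior the exponential of [EBt] shifts the rate to [Bq],
    and [(1 + t) * t ^ (- 1/2)] splits into the shapes [alpha + 1/2] and [alpha - 1/2]. *)
Lemma kappa_mul_IG alpha beta x y a b t :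
  a <= x <= b -> a < y < b -> 3 / 2 < alpha -> 0 < beta ->
  kappa x t a b y * IG alpha beta t = (Gamma alpha)^-1 * Mq alpha beta x y a b t.
Proof.
move=> axb ayb al b0.
(* For [t <= 0] both sides vanish with [IG], so the identity holds for every real [t]. *)
have [t0|t0] := ltP 0 t; last first.
  have IG0 s c : IG s c t = 0 by rewrite /IG ltNge t0.
  by rewrite /Mq !IG0 !mulr0 addr0 !if_same mulr0.
have a0 : 0 < alpha by lra.
rewrite /kappa /Mq; case: eqP => [->|/eqP xa] /=.
  by rewrite EB_left// kernel_edge_mul_IG//; exact: (Eq_gt0 b0 ayb).
case: eqP => [->|/eqP xb] /=.
  by rewrite EB_right// kernel_edge_mul_IG//; exact: (Gq_gt0 b0 ayb).
have axb' : a < x < b by rewrite !lt_neqAle eq_sym xa xb.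
have B0 := Bq_gt0 b0 axb' ayb.
have ba : b - a != 0 by rewrite gt_eqF//; lra.
have t1 : t != 0 by rewrite gt_eqF.
have a1 : 0 < alpha + 2^-1 by lra.
have a2 : 0 < alpha - 2^-1 by lra.
have h1 := Gamma_powR_IG a1 B0 t0; rewrite (opprD alpha) in h1.
have h2 := Gamma_powR_IG a2 B0 t0; rewrite (opprB alpha) [_ - alpha]addrC in h2.
rewrite /Aq /Cq /EBt ayb; set S := Num.sqrt _.
rewrite -!mulrA !(mulrA (Gamma _)) h1 h2.
(* All powers of [t] are reduced to [t ^ (- alpha - 1)], [t ^ (- 1/2)] and [t] itself, so that
   [field] can treat the first two as atoms. *)
rewrite (powRD1 (p := - alpha + 2^-1 - 1) (q := - alpha - 2^-1 - 1) t0); last by field.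
rewrite {1}/IG t0.
have -> : t `^ (- alpha - 2^-1 - 1) = t `^ (- alpha - 1) * t `^ (- 2^-1).
  by rewrite -powRD ?t1 ?implybT//; congr powR; ring.
rewrite /Bq.
set L := (x - a) * _ + _.
have -> : - ((beta - (b - a)^-1 * L) / t) = ((b - a) * t)^-1 * L - beta / t.
  by field; rewrite ba t1.
rewrite expRD !expRN.
have S0 : S != 0.
  rewrite gt_eqF// sqrtr_gt0 !mulr_gt0 ?pi_gt0//; lra.
have G0 : Gamma alpha != 0 by rewrite gt_eqF// Gamma_gt0.
by field; rewrite S0 G0 gt_eqF ?expR_gt0.
Qed.

Lemma has_integral_Mq alpha beta x y a b :
  a <= x <= b -> a < y < b -> 3 / 2 < alpha -> 0 < beta ->
  has_integral (Mq alpha beta x y a b) (wq alpha beta x y a b).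
Proof.
move=> axb ayb al b0; rewrite /Mq /wq.
have IGc c s B : 0 < s -> 0 < B -> has_integral (fun t => c * IG s B t) c.
  by move=> s0 B0; rewrite -[X in has_integral _ X]mulr1; apply/has_integralZ/has_integral_IG.
have E0 := Eq_gt0 b0 ayb; have G0 := Gq_gt0 b0 ayb.
case: eqP => [_|/eqP xa]; first by apply: has_integralD; apply: IGc => //; lra.
case: eqP => [_|/eqP xb]; first by apply: has_integralD; apply: IGc => //; lra.
have axb' : a < x < b by rewrite !lt_neqAle eq_sym xa xb.
have B0 := Bq_gt0 b0 axb' ayb.
by apply: has_integralD; apply: IGc => //; lra.
Qed.

(** An inverse gamma mean needs shape above 1; for the smallest shape, [alpha - 1/2], this is the
    hypothesis [3 / 2 < alpha]. *)
Lemma has_integral_Mq_mean alpha beta x y a b :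
  a <= x <= b -> a < y < b -> 3 / 2 < alpha -> 0 < beta ->
  has_integral (fun t => t * Mq alpha beta x y a b t) (muq alpha beta x y a b).
Proof.
move=> axb ayb al b0; rewrite /Mq /muq.
have IGc c c' s s' B : 1 < s -> 1 < s' -> 0 < B ->
    has_integral (fun t => t * (c * IG s B t + c' * IG s' B t))
                 (B * (c / (s - 1) + c' / (s' - 1))).
  move=> s0 s0' B0.
  rewrite (_ : B * _ = c * (B / (s - 1)) + c' * (B / (s' - 1))); last by ring.
  apply: eq_has_integral (has_integralD
    (has_integralZ c (has_integral_IG_mean s0 B0))
    (has_integralZ c' (has_integral_IG_mean s0' B0))) => t _.
  by ring.
have E0 := Eq_gt0 b0 ayb; have G0 := Gq_gt0 b0 ayb.
(* The denominators in [muq] are simplified; they are rewritten as shape minus one to match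
   [IGc]. *)
have aE : alpha + 1 - 1 = alpha by ring.
case: eqP => [_|/eqP xa]; first by rewrite -[X in _ + _ / X]aE; apply: IGc => //; lra.
case: eqP => [_|/eqP xb]; first by rewrite -[X in _ + _ / X]aE; apply: IGc => //; lra.
have axb' : a < x < b by rewrite !lt_neqAle eq_sym xa xb.
have B0 := Bq_gt0 b0 axb' ayb.
have -> : alpha - 3 / 2 = alpha - 2^-1 - 1 by lra.
have -> : alpha - 2^-1 = alpha + 2^-1 - 1 by lra.
by apply: IGc => //; lra.
Qed.

Lemma wq_gt0 alpha beta x y a b :
  a <= x <= b -> a < y < b -> 3 / 2 < alpha -> 0 < beta ->
  0 < wq alpha beta x y a b.
Proof.
move=> axb ayb al b0.
have ba : 0 < (b - a)^-1 by rewrite invr_gt0; lra.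
have E0 := Eq_gt0 b0 ayb; have G0 := Gq_gt0 b0 ayb.
rewrite /wq; case: eqP => [_|/eqP xa].
  by rewrite addr_gt0// !mulr_gt0 ?powR_gt0 ?Gamma_gt0//; lra.
case: eqP => [_|/eqP xb].
  by rewrite addr_gt0// !mulr_gt0 ?powR_gt0 ?Gamma_gt0//; lra.
have axb' : a < x < b by rewrite !lt_neqAle eq_sym xa xb.
have B0 := Bq_gt0 b0 axb' ayb.
have S0 : 0 < (Num.sqrt (2 * pi * (x - a) * (b - x)))^-1.
  rewrite invr_gt0 sqrtr_gt0 !mulr_gt0 ?pi_gt0//; lra.
by rewrite addr_gt0// !mulr_gt0 ?powR_gt0 ?Gamma_gt0//; lra.
Qed.

End kernels.

(** * Iterated integration of sums of products over the orthant *)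

Section orthant.
Set Implicit Arguments.
Unset Strict Implicit.
Context {R : realType}.

(** The integral is iterated by definition, so the coordinates are integrated out one at a time,
    each as a linear combination of one-dimensional integrals. *)
Lemma int_pos_orthant_sum_prod (n d : nat) (P : pred 'I_n) (K : R)
    (g : 'I_n -> 'I_d -> R -> R) (v : 'I_n -> 'I_d -> R) :
  (forall j l, P j -> has_integral (g j l) (v j l)) ->
  int_pos_orthant (fun h => (K * \sum_(j | P j) \prod_l g j l (h l))%:E) =
  (K * \sum_(j | P j) \prod_l v j l)%:E.
Proof.
move=> gv; rewrite /int_pos_orthant.
set F := (fun h : nat -> R => _).
(* Induction invariant: coordinates below [k] are already replaced by their integrals, the others
   are still read from [h0]. *)
have H k h0 : (k <= d)%N -> iint k F h0 = (K * \sum_(j | P j) \prod_(l < d)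
    if (l < k)%N then v j l else g j l (h0 l))%:E.
  elim: k h0 => [|k ih] h0 kd //=.
  under eq_integral do rewrite ih ?(ltnW kd)//.
  pose lk := Ordinal kd.
  (* The factors outside coordinate [k] are constant in the current variable. *)
  pose c j := \prod_(l < d | l != lk) if (l < k.+1)%N then v j l else g j l (h0 l).
  have E : has_integral (fun t => K * \sum_(j | P j) c j * g j lk t)
                        (K * \sum_(j | P j) c j * v j lk).
    by apply: has_integralZ; apply: has_integral_sum => j Pj;
      apply: has_integralZ; exact: gv.
  transitivity (K * \sum_(j | P j) c j * v j lk)%:E; last first.
    congr (_ * _)%:E; apply: eq_bigr => j _.
    by rewrite (bigD1 lk)//= ltnSn mulrC.
  case: E => _ <-; apply: eq_integral => t _; congr (_ * _)%:E.
  apply: eq_bigr => j _; rewrite (bigD1 lk)//= ltnn eqxx mulrC; congr (_ * _).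
  apply: eq_bigr => l llk.
  have lk' : (l == k :> nat) = false by apply/negbTE: llk.
  by rewrite lk' ltnS [in RHS]leq_eqVlt lk'.
rewrite H//; congr (_ * _)%:E; apply: eq_bigr => j _; apply: eq_bigr => l _.
by rewrite ltn_ord.
Qed.

End orthant.

(** * The posterior density and the posterior mean *)

Theorem theorem1 (R : realType) (n d : nat) (a b : 'I_d -> R)
    (X : 'I_n -> 'I_d -> R) (i : 'I_n) (alpha : R) (beta : 'I_d -> R) :
  (2 <= n)%N ->
  (forall l, a l < b l) ->
  (forall j l, a l <= X j l <= b l) ->
  (forall j l, j != i -> a l < X j l < b l) ->
  3 / 2 < alpha ->
  (forall l, 0 < beta l) ->
  let w j l := wq alpha (beta l) (X i l) (X j l) (a l) (b l) in
  let M j l t := Mq alpha (beta l) (X i l) (X j l) (a l) (b l) t in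
  let mu j l := muq alpha (beta l) (X i l) (X j l) (a l) (b l) in
  let D := \sum_(j < n | j != i) \prod_(l < d) w j l in
  (forall h : 'I_d -> R, (forall l, 0 < h l) ->
     posterior a b X i alpha beta h =
     D^-1 * \sum_(j < n | j != i) \prod_(l < d) M j l (h l)) /\
  (forall m : 'I_d,
     post_mean a b X i alpha beta m =
     (D^-1 * \sum_(j < n | j != i)
        ((\prod_(l < d | l != m) w j l) * mu j m))%:E).
Proof.
move=> n2 ab Xab Xab' al b0 w M mu D.
have al0 : 0 < alpha by lra.
(* The constant common to numerator and normaliser: the averaging factor of the estimator and one
   [(Gamma alpha)^-1] per coordinate. *)
pose K : R := n.-1%:R^-1 * \prod_(l < d) (Gamma alpha)^-1.
have K0 : K != 0.
  rewrite mulf_neq0// ?invr_eq0.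
    by rewrite pnatr_eq0 -lt0n; case: n n2 {X i Xab Xab' w M mu D K} => [|[]].
  by rewrite prodr_const expf_neq0// invr_eq0 gt_eqF// Gamma_gt0.
(* Valid for all [h], not only positive ones, so it can be rewritten under the integral by function
   extensionality. *)
have fE h : fhat_loo a b X i h * prior alpha beta h =
    K * \sum_(j < n | j != i) \prod_(l < d) M j l (h l).
  rewrite /fhat_loo /prior /K -!mulrA; congr (_ * _).
  rewrite big_distrl big_distrr/=; apply: eq_bigr => j ji.
  rewrite -!big_split/=; apply: eq_bigr => l _.
  by rewrite kappa_mul_IG//; exact: Xab'.
have Mint j l : j != i -> has_integral (M j l) (w j l).
  by move=> ji; apply: has_integral_Mq => //; exact: Xab'.
have D0 : D != 0.
  have w0 j l : j != i -> 0 < w j l.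
    by move=> ji; apply: wq_gt0 => //; exact: Xab'.
  (* Since [2 <= n], the sum [D] of positive terms is not empty. *)
  have [j ji] : exists j, j != i.
    have := cardC1 i; rewrite card_ord => cardi.
    have /card_gt0P[j] : (0 < #|predC1 i|)%N by rewrite cardi; case: (n) n2 => [|[]].
    by rewrite inE => ji; exists j.
  rewrite gt_eqF// /D (bigD1 j)//= ltr_wpDr//.
    by apply: sumr_ge0 => k /andP[ki _]; apply: prodr_ge0 => l _; exact/ltW/w0.
  by apply: prodr_gt0 => l _; exact: w0.
have postE h : posterior a b X i alpha beta h =
    D^-1 * \sum_(j < n | j != i) \prod_(l < d) M j l (h l).
  rewrite /posterior fE.
  have -> : (fun g => (fhat_loo a b X i g * prior alpha beta g)%:E) =
      (fun g => (K * \sum_(j < n | j != i) \prod_(l < d) M j l (g l))%:E).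
    by apply/funext => g; rewrite fE.
  (* The normaliser equals [K * D], and [K] cancels. *)
  rewrite (int_pos_orthant_sum_prod _ Mint)/= -/D.
  by rewrite -mulf_div divff// mul1r mulrC.
split=> [h _|m]; first exact: postE.
(* The factor [h m] is absorbed into coordinate [m], so the integrand is again a sum of products and
   only that factor integrates to a mean. *)
pose g j l t := if l == m then t * M j l t else M j l t.
pose v j l := if l == m then mu j l else w j l.
have gv j l : j != i -> has_integral (g j l) (v j l).
  move=> ji; rewrite /g /v; case: ifPn => _; last exact: Mint.
  by apply: has_integral_Mq_mean => //; exact: Xab'.
have prodm (F G : 'I_d -> R) : \prod_(l < d) (if l == m then G l else F l) =
    (\prod_(l < d | l != m) F l) * G m.
  rewrite (bigD1 m)//= eqxx mulrC; congr (_ * _).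
  by apply: eq_bigr => l /negbTE ->.
rewrite /post_mean.
have -> : (fun h => (h m * posterior a b X i alpha beta h)%:E) =
    (fun h => (D^-1 * \sum_(j < n | j != i) \prod_(l < d) g j l (h l))%:E).
  apply/funext => h; rewrite postE mulrCA mulr_sumr; congr (_ * _)%:E.
  apply: eq_bigr => j _.
  rewrite (prodm (fun l => M j l (h l)) (fun l => h l * M j l (h l))).
  by rewrite (bigD1 m)//= mulrA mulrC.
rewrite (int_pos_orthant_sum_prod _ gv); congr (_ * _)%:E.
by apply: eq_bigr => j _; exact: (prodm (w j) (mu j)).
Qed.
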